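(* Every lower-modular semigroup variety is modular.
   Context: $\mathbf{SEM}$ denotes the lattice of all semigroup varieties (classes of semigroups defined by semigroup identities) ordered by class-theoretical inclusion. An element $x$ of a lattice $\langle L;\vee,\wedge\rangle$ is called modular if for all $y,z\in L$, $y\le z$ implies $(x\vee y)\wedge z=(x\wedge z)\vee y$; it is called lower-modular if for all $y,z\in L$, $x\le y$ implies $x\vee(y\wedge z)=y\wedge(x\vee z)$. A semigroup variety is called modular (respectively, lower-modular) if it is a modular (respectively, lower-modular) element of the lattice $\mathbf{SEM}$. *)

(* Defs.v *)
From HB Require Import structures.
From mathcomp Require Import all_boot all_order.
From mathcomp Require Import boolp classical_sets.

Set Implicit Arguments.
Unset Strict Implicit.
Unset Printing Implicit Defensive.

Import Order.Theory.

Local Open Scope classical_set_scope.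

Section LatticeElements.
Context {d : Order.disp_t} {L : latticeType d}.
Local Open Scope order_scope.

Definition modular_element (x : L) : Prop :=
  forall y z : L, y <= z -> (x `|` y) `&` z = (x `&` z) `|` y.

Definition lower_modular_element (x : L) : Prop :=
  forall y z : L, x <= y -> x `|` (y `&` z) = y `&` (x `|` z).

End LatticeElements.

(* The type of varieties must be a choiceType to form a [latticeType], so the
   universe of carriers lies strictly below that of eqTypes. For this reason
   [semigroupType] cannot be used here, and types that MathComp places in a fixed
   universe ('I_n, n.-tuple T, set T) cannot be carriers as they stand; nat,
   seq nat, seq nat -> Prop and their sums, products and subtypes can. *)
Record semigroup : Type := Semigroup {
  semigroup_sort :> Type;
  semigroup_mul : semigroup_sort -> semigroup_sort -> semigroup_sort;
  semigroup_mulA : associative semigroup_mul;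
  semigroup_inhabited : inhabited semigroup_sort
}.

(* An element of the free semigroup on countably many letters: the pair (x, s)
   stands for the nonempty word x :: s. *)
Definition word := (nat * seq nat)%type.

Definition identity := (word * word)%type.

Definition eval_word (S : semigroup) (phi : nat -> S) (w : word) : S :=
  foldl (fun a i => semigroup_mul a (phi i)) (phi w.1) w.2.

Definition satisfies (S : semigroup) (e : identity) : Prop :=
  forall phi : nat -> S, eval_word phi e.1 = eval_word phi e.2.

Definition models (E : set identity) : set semigroup :=
  [set S | forall e, E e -> satisfies S e].

Definition identities (K : set semigroup) : set identity :=
  [set e | forall S, K S -> satisfies S e].

Record semigroup_variety : Type := SemigroupVariety {
  variety_class :> set semigroup;
  variety_classP : exists E : set identity, variety_class = models E
}.

Lemma variety_inj : injective variety_class.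
Proof.
move=> [K hK] [K' hK'] /= KK'; case: _ / KK' hK' => hK'.
by rewrite (Prop_irrelevance hK hK').
Qed.

Lemma models_identitiesK (E : set identity) :
  models (identities (models E)) = models E.
Proof.
apply/seteqP; split=> S SE e => [Ee|]; last exact.
by apply: SE => S'; apply.
Qed.

Lemma variety_modelsE (V : semigroup_variety) :
  variety_class V = models (identities V).
Proof. by have [E VE] := variety_classP V; rewrite VE models_identitiesK. Qed.

Lemma models_setU (E F : set identity) :
  models E `&` models F = models (E `|` F).
Proof.
apply/seteqP; split=> S /=.
- by move=> [SE SF] e [/SE|/SF].
- by move=> SEF; split=> e He; apply: SEF; [left|right].
Qed.

Lemma variety_meet_subproof (X Y : semigroup_variety) :
  exists E, (X : set semigroup) `&` Y = models E.
Proof.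
exists (identities X `|` identities Y).
by rewrite -models_setU -!variety_modelsE.
Qed.

Definition variety_meet (X Y : semigroup_variety) : semigroup_variety :=
  SemigroupVariety (variety_meet_subproof X Y).

(* The join is the least variety containing both classes: it is defined by the
   identities that hold throughout their union. *)
Definition variety_join (X Y : semigroup_variety) : semigroup_variety :=
  SemigroupVariety
    (ex_intro _ (identities ((X : set semigroup) `|` Y)) erefl).

Definition variety_le (X Y : semigroup_variety) : bool :=
  `[< (X : set semigroup) `<=` Y >].

Lemma variety_le_refl : reflexive variety_le.
Proof. by move=> X; apply/asboolP. Qed.

Lemma variety_le_anti : antisymmetric variety_le.
Proof.
by move=> X Y /andP[/asboolP XY /asboolP YX]; apply/variety_inj/seteqP.
Qed.

Lemma variety_le_trans : transitive variety_le.
Proof.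
move=> Y X Z /asboolP XY /asboolP YZ.
by apply/asboolP; apply: (subset_trans XY YZ).
Qed.

HB.instance Definition _ := gen_eqMixin semigroup_variety.
HB.instance Definition _ := gen_choiceMixin semigroup_variety.
HB.instance Definition _ := Order.Le_isPOrder.Build (Order.Disp tt tt)
  semigroup_variety variety_le_refl variety_le_anti variety_le_trans.

Lemma variety_leP (X Y : semigroup_variety) :
  reflect ((X : set semigroup) `<=` Y) (X <= Y)%O.
Proof. exact: asboolP. Qed.

Lemma variety_meetP (X Y Z : semigroup_variety) :
  (X <= variety_meet Y Z)%O = (X <= Y)%O && (X <= Z)%O.
Proof.
apply/idP/andP => [/variety_leP XYZ|[/variety_leP XY /variety_leP XZ]].
- by split; apply/variety_leP => S /XYZ[].
- by apply/variety_leP => S XS; split; [apply: XY|apply: XZ].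
Qed.

Lemma variety_joinP (X Y Z : semigroup_variety) :
  (variety_join X Y <= Z)%O = (X <= Z)%O && (Y <= Z)%O.
Proof.
apply/idP/andP => [/variety_leP XYZ|[/variety_leP XZ /variety_leP YZ]].
- by split; apply/variety_leP => S HS; apply: XYZ => e; apply; [left|right].
- apply/variety_leP => S SXY; rewrite variety_modelsE => e eZ; apply: SXY.
  by move=> S' [/XZ|/YZ]; apply: eZ.
Qed.

HB.instance Definition _ := Order.POrder_MeetJoin_isLattice.Build
  (Order.Disp tt tt) semigroup_variety variety_meetP variety_joinP.

(* The lattice of all semigroup varieties under class inclusion. *)
Definition SEM : latticeType (Order.Disp tt tt) := semigroup_variety.

Definition modular_variety (V : semigroup_variety) : Prop :=
  modular_element (V : SEM).

Definition lower_modular_variety (V : semigroup_variety) : Prop :=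
  lower_modular_element (V : SEM).

(* Main.v *)
Require Import Defs.
From mathcomp Require Import all_boot all_order.
From mathcomp Require Import boolp classical_sets.
From mathcomp Require Import zify.

Set Implicit Arguments.
Unset Strict Implicit.
Unset Printing Implicit Defensive.

(** Varieties correspond to equational theories, that is, to fully invariant
    congruences on the free semigroup, with the order reversed: the theory of a
    meet is the join of the theories, the theory of a join their intersection.
    Lower modularity of V, with theory alpha, then says: whenever E is contained
    in alpha, every identity of alpha derivable from E and G together is derivable
    from E together with the identities that belong both to alpha and to the
    theory of G.  In particular, if u = v is such a nontrivial identity and E
    cannot rewrite u at all, then u = w is in alpha for some other word w of the
    G-class of u ([lower_modular_move]).  So one looks for a path from u to v via
    G, E, G for which the G-class of u is well understood.

    Take a nontrivial identity u = v of V with u no longer than v.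

    - With G = {u = uu, v = vv} and E = {uu = vv}, every word of the G-class of u
      has u as prefix and as suffix and has the letters of u.  Hence u = pu holds
      in V for some p with the same letters as u ([lower_modular_absorb]).
      Sending all letters to one letter shows that V is periodic.
    - Once x^m = x^(m+d) holds, let p and q have the same letters and z be another
      letter.  Among words of one fixed length take u = p^a z^b and
      s = z^c q^e; periodicity gives companions v of u and s' of s in alpha of the
      same length.  Put G = {u = s, v = s'} and E = {s = s'}.  Between
      words of equal length an identity acts only through substitutions of letters
      for letters, and the exponents are chosen so that no such substitution
      connects these words unexpectedly: E cannot rewrite u and the G-class of u
      is {u, s}, so V satisfies p^a z^b = z^c q^e
      ([lower_modular_exchange]).  For p = q = x this forces d = 1, and then for
      arbitrary p and q, by substituting p and q for z, it gives p^M = q^M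
      ([lower_modular_power]).

    Altogether ([lower_modular_shape]), if alpha is not the equality then for some
    M > 1 the power p^M depends, in V, only on the letters of p, and every u
    lying in a nontrivial alpha-class satisfies u = u^M.  Call u full if
    u = u^M is in alpha: the full words form a fully invariant ideal, outside of
    which alpha is the equality, and on which alpha relates the words with the
    same letters, or all words if some identity of V changes the set of letters.

    Congruences alpha of this form are modular.  Let Y and Z be varieties with
    Y <= Z and let u = v hold both in Y and in the meet of V and Z.  If
    a derivation uses V at all, Z moves u to a full word p and v to a full word q.
    If p and q are not already related by alpha, then V preserves sets of letters
    while Z does not, and an identity of Z that adds letters allows one to extend
    p and q, modulo the theory of (V \/ Y) /\ Z, to full words having the letters
    of both ([full_extend]); those are related by alpha. *)

Import Order.Theory.

Local Open Scope classical_set_scope.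

(** * Words, substitutions and derivations *)

(** Derivations live on sequences, so that contexts may be empty; words proper are
    the nonempty sequences. *)
Definition letters (w : word) : seq nat := w.1 :: w.2.

(** Only meant for nonempty sequences. *)
Definition word_of (s : seq nat) : word := (head 0 s, behead s).

Lemma word_ofK s : s != [::] -> letters (word_of s) = s.
Proof. by case: s. Qed.

Lemma lettersK w : word_of (letters w) = w.
Proof. by case: w. Qed.

Definition subst (f : nat -> word) (s : seq nat) : seq nat :=
  flatten [seq letters (f x) | x <- s].

Lemma subst_cons f x s : subst f (x :: s) = letters (f x) ++ subst f s.
Proof. by []. Qed.

Lemma subst1 f x : subst f [:: x] = letters (f x).
Proof. exact: cats0. Qed.

Lemma subst_cat f s t : subst f (s ++ t) = subst f s ++ subst f t.
Proof. by rewrite /subst map_cat flatten_cat. Qed.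

Lemma subst_comp f g s :
  subst f (subst g s) = subst (fun x => word_of (subst f (letters (g x)))) s.
Proof. by elim: s => //= x s IH; rewrite [LHS]subst_cat IH. Qed.

Lemma size_subst f s : size s <= size (subst f s).
Proof. by elim: s => // x s IH; rewrite subst_cons size_cat /=; lia. Qed.

Lemma mem_subst f s y :
  reflect (exists2 x, x \in s & y \in letters (f x)) (y \in subst f s).
Proof.
apply: (iffP flatten_mapP) => -[x xs yx]; first by exists x.
by exists x.
Qed.

Definition step (E : set identity) (w w' : seq nat) : Prop :=
  exists a b f l r, [/\ E (l, r) \/ E (r, l),
    w = a ++ subst f (letters l) ++ b & w' = a ++ subst f (letters r) ++ b].

Inductive deriv (E : set identity) : seq nat -> seq nat -> Prop :=
| deriv_refl w : deriv E w w
| deriv_step w1 w2 w3 : step E w1 w2 -> deriv E w2 w3 -> deriv E w1 w3.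

Arguments deriv_refl {E}.

Section Derivations.
Variable E : set identity.

Lemma step_sym u v : step E u v -> step E v u.
Proof.
by move=> [a [b [f [l [r [Elr -> ->]]]]]]; exists a, b, f, r, l; split=> //; tauto.
Qed.

Lemma step_cat a b u v : step E u v -> step E (a ++ u ++ b) (a ++ v ++ b).
Proof.
move=> [a' [b' [f [l [r [Elr -> ->]]]]]].
by exists (a ++ a'), (b' ++ b), f, l, r; split; rewrite // !catA.
Qed.

Lemma step_subst g u v : step E u v -> step E (subst g u) (subst g v).
Proof.
move=> [a [b [f [l [r [Elr -> ->]]]]]].
exists (subst g a), (subst g b), (fun x => word_of (subst g (letters (f x)))), l, r.
by split=> //; rewrite !subst_cat subst_comp.
Qed.

Lemma deriv_trans v u w : deriv E u v -> deriv E v w -> deriv E u w.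
Proof. by elim=> // w1 w2 w3 s12 _ IH /IH; apply: deriv_step. Qed.

Lemma deriv_step1 u v : step E u v -> deriv E u v.
Proof. by move=> s; apply: deriv_step s _; apply: deriv_refl. Qed.

Lemma deriv_sym u v : deriv E u v -> deriv E v u.
Proof.
elim=> [w|w1 w2 w3 s12 _ IH]; first exact: deriv_refl.
by apply: deriv_trans IH _; apply/deriv_step1/step_sym.
Qed.

Lemma deriv_ctx a b u v : deriv E u v -> deriv E (a ++ u ++ b) (a ++ v ++ b).
Proof.
elim=> [w|w1 w2 w3 s12 _ IH]; first exact: deriv_refl.
by apply: deriv_step IH; apply: step_cat.
Qed.

Lemma deriv_cat u v u' v' :
  deriv E u v -> deriv E u' v' -> deriv E (u ++ u') (v ++ v').
Proof.
move=> uv uv'; apply: (deriv_trans (deriv_ctx [::] u' uv)).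
by have := deriv_ctx v [::] uv'; rewrite !cats0.
Qed.

Lemma deriv_subst f u v : deriv E u v -> deriv E (subst f u) (subst f v).
Proof.
elim=> [w|w1 w2 w3 s12 _ IH]; first exact: deriv_refl.
by apply: deriv_step IH; apply: step_subst.
Qed.

Lemma subst_letter s : subst (fun x => (x, [::])) s = s.
Proof. by elim: s => //= x s IH; rewrite [LHS]/= -[in RHS]IH. Qed.

Lemma deriv_axiom e : E e -> deriv E (letters e.1) (letters e.2).
Proof.
case: e => l r Elr; apply: deriv_step1.
exists [::], [::], (fun x => (x, [::])), l, r.
by rewrite !subst_letter !cats0; split=> //; left.
Qed.

Lemma step_nil u : ~ step E [::] u.
Proof. by move=> [a [b [f [l [r [_ + _]]]]]]; case: a. Qed.

Lemma deriv_nil u v : deriv E u v -> u = [::] -> v = [::].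
Proof.
by case=> [w //|w1 w2 w3 s12 _ w10]; rewrite w10 in s12; case: (step_nil s12).
Qed.

(** A step may leave its word unchanged, so the first step that matters has to be
    looked for. *)
Lemma deriv_first u v :
  deriv E u v -> u <> v -> exists2 w, step E u w & w <> u.
Proof.
elim=> [w //|w1 w2 w3 s12 _ IH n13].
have [e12|n12] := EM (w2 = w1); last by exists w2.
by move: IH; rewrite e12; apply.
Qed.

End Derivations.

Lemma deriv_sub (E F : set identity) u v :
  (forall e, E e -> deriv F (letters e.1) (letters e.2)) ->
  deriv E u v -> deriv F u v.
Proof.
move=> EF; elim=> [w|w1 w2 w3 [a [b [f [l [r [Elr -> ->]]]]]] _].
  exact: deriv_refl.
apply: deriv_trans; apply: deriv_ctx; apply: deriv_subst.
by case: Elr => /EF //= /deriv_sym.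
Qed.

(** * Birkhoff completeness *)

(** Evaluation of possibly empty sequences takes place in S with an identity
    adjoined, represented by None; this makes it multiplicative on contexts. *)
Section Evaluation.
Variable S : semigroup.

Definition omul (x y : option S) : option S :=
  match x, y with
  | Some a, Some b => Some (semigroup_mul a b)
  | None, _ => y
  | _, None => x
  end.

Lemma omulA : associative omul.
Proof. by move=> [x|] [y|] [z|] //=; rewrite semigroup_mulA. Qed.

Arguments omul : simpl never.

Definition oeval (phi : nat -> S) (s : seq nat) : option S :=
  foldr (fun i => omul (Some (phi i))) None s.

Lemma oeval_cat phi s t : oeval phi (s ++ t) = omul (oeval phi s) (oeval phi t).
Proof. by elim: s => //= i s ->; rewrite omulA. Qed.

Lemma oeval_letters phi w : oeval phi (letters w) = Some (eval_word phi w).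
Proof.
case: w => x s; elim/last_ind: s => // s y IH.
have -> : letters (x, rcons s y) = letters (x, s) ++ [:: y].
  by rewrite /letters /= cats1.
by rewrite oeval_cat IH /eval_word /= foldl_rcons.
Qed.

Lemma oeval_subst phi f s :
  oeval phi (subst f s) = oeval (fun i => eval_word phi (f i)) s.
Proof.
by elim: s => // i s IH; rewrite subst_cons oeval_cat oeval_letters IH.
Qed.

Lemma deriv_sound (E : set identity) u v :
  models E S -> deriv E u v -> forall phi, oeval phi u = oeval phi v.
Proof.
move=> SE + phi; elim=> // w1 w2 w3 [a [b [f [l [r [Elr -> ->]]]]]] _ <-.
rewrite !(oeval_cat _ a) !(oeval_cat _ _ b) !oeval_subst !oeval_letters.
suff -> : eval_word (fun i => eval_word phi (f i)) l
        = eval_word (fun i => eval_word phi (f i)) r by [].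
by case: Elr => /SE /(_ (fun i => eval_word phi (f i))).
Qed.

End Evaluation.

(** The relatively free semigroup of the class defined by E.  Derivably equal words
    have the same set of derivable words, so the choice operator gives them the
    same representative; the quotient is carried by these representatives. *)
Section FreeObject.
Variable E : set identity.

Definition canon (w : word) : word :=
  xget (0, [::]) [set v | deriv E (letters w) (letters v)].

Lemma deriv_canon w : deriv E (letters w) (letters (canon w)).
Proof.
by apply: (@xgetPex _ _ [set v | deriv E (letters w) (letters v)]); exists w;
  apply: deriv_refl.
Qed.

Lemma canon_eq w w' : deriv E (letters w) (letters w') -> canon w = canon w'.
Proof.
move=> ww'; rewrite /canon; congr xget; apply/seteqP; split=> v /=.
- exact/deriv_trans/deriv_sym.
- exact: deriv_trans.
Qed.

Lemma canonK w : canon (canon w) = canon w.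
Proof. exact/esym/canon_eq/deriv_canon. Qed.

Definition free_sort := {w : word | canon w = w}.

Definition free_class (w : word) : free_sort := exist _ (canon w) (canonK w).

Lemma free_class_eq w w' :
  deriv E (letters w) (letters w') -> free_class w = free_class w'.
Proof. by move=> ww'; apply: eq_exist; apply: canon_eq. Qed.

Lemma free_class_inj w w' :
  free_class w = free_class w' -> deriv E (letters w) (letters w').
Proof.
move=> [eqc]; apply: deriv_trans (deriv_canon w) _.
by rewrite eqc; apply/deriv_sym/deriv_canon.
Qed.

Definition wmul (v w : word) : word := (v.1, v.2 ++ letters w).

Lemma letters_wmul v w : letters (wmul v w) = letters v ++ letters w.
Proof. by []. Qed.

Definition free_mul (x y : free_sort) : free_sort :=
  free_class (wmul (sval x) (sval y)).

Lemma free_mul_class v w :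
  free_mul (free_class v) (free_class w) = free_class (wmul v w).
Proof.
apply: free_class_eq; rewrite !letters_wmul.
by apply: deriv_cat; apply/deriv_sym/deriv_canon.
Qed.

Lemma sval_free_class (x : free_sort) : free_class (sval x) = x.
Proof. by case: x => w cw; apply: eq_exist. Qed.

Lemma free_mulA : associative free_mul.
Proof.
move=> x y z; rewrite -[x]sval_free_class -[y]sval_free_class -[z]sval_free_class.
by rewrite !free_mul_class /wmul /= -catA.
Qed.

Definition free_semigroup : semigroup :=
  Defs.Semigroup free_mulA (inhabits (free_class (0, [::]))).

Lemma eval_free (f : nat -> word) w :
  eval_word (S := free_semigroup) (fun i => free_class (f i)) w =
  free_class (word_of (subst f (letters w))).
Proof.
case: w => x s; elim/last_ind: s => [|s y IH].
  by rewrite /letters subst_cons cats0 lettersK.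
rewrite {1}/eval_word foldl_rcons -/(eval_word _ (x, s)) IH.
rewrite [LHS]free_mul_class; congr free_class.
by rewrite /wmul /letters /= -cats1 -cat_cons subst_cat (subst_cons f y) cats0.
Qed.

Lemma free_models : models E free_semigroup.
Proof.
move=> [l r] Elr phi /=.
have -> : phi = fun i => free_class (sval (phi i)).
  by apply/funext => i; rewrite sval_free_class.
rewrite !eval_free; apply: free_class_eq; rewrite !word_ofK //.
exact/deriv_subst/(@deriv_axiom E (l, r)).
Qed.

Lemma deriv_complete l r :
  identities (models E) (l, r) -> deriv E (letters l) (letters r).
Proof.
move=> /(_ _ free_models) /(_ (fun i => free_class (i, [::]))) /=.
by rewrite !eval_free !subst_letter !lettersK => /free_class_inj.
Qed.

End FreeObject.

Lemma deriv_identities (E : set identity) l r :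
  deriv E (letters l) (letters r) <-> identities (models E) (l, r).
Proof.
split=> [lr S SE phi|]; last exact: deriv_complete.
by have := deriv_sound SE lr phi; rewrite !oeval_letters => -[].
Qed.

(** * Lower modularity as a property of derivations *)

(** The equational theory of V, extended to possibly empty sequences. *)
Definition theory (V : semigroup_variety) : seq nat -> seq nat -> Prop :=
  deriv (identities V).

Lemma theoryP V l r : theory V (letters l) (letters r) <-> identities V (l, r).
Proof. by rewrite /theory deriv_identities -variety_modelsE. Qed.

Definition variety_of (E : set identity) : semigroup_variety :=
  SemigroupVariety (ex_intro _ E erefl).

(** Lower modularity at the varieties defined by E and G: the theory of
    V \/ (Y /\ Z) is the intersection of the theory of V with what E and G derive,
    and the theory of Y /\ (V \/ Z) is generated by E and by the identities common
    to V and Z. *)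
Lemma lower_modular_deriv V (E G : set identity) u v :
  lower_modular_variety V -> E `<=` identities V ->
  theory V u v -> deriv (E `|` G) u v ->
  deriv (E `|` [set e | identities V e /\
                        deriv G (letters e.1) (letters e.2)]) u v.
Proof.
move=> lmV EV uvV uvEG.
have [u0|/word_ofK u'] := eqVneq u [::].
  by rewrite u0 in uvEG *; rewrite (deriv_nil uvEG erefl); apply: deriv_refl.
have [v0|/word_ofK v'] := eqVneq v [::].
  rewrite v0 in uvEG *; rewrite (deriv_nil (deriv_sym uvEG) erefl).
  exact: deriv_refl.
rewrite -u' -v' in uvV uvEG *.
set Y := variety_of E; set Z := variety_of G.
have VY : (V <= Y)%O.
  apply/variety_leP => S; rewrite [X in X S -> _]variety_modelsE => VS e Ee.
  exact/VS/EV.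
apply: deriv_complete => S SEG.
have YZS : variety_class (Y `&` (V `|` Z))%O S.
  split=> [e Ee|]; first by apply: SEG; left.
  move=> [l r] lr; apply: SEG; right; split=> [S' VS'|]; first by apply: lr; left.
  by apply: deriv_complete => S' ZS'; apply: lr; right.
move: YZS; rewrite -(lmV Y Z VY); apply => S' [VS'|[YS' ZS']].
- by move/theoryP: uvV; apply.
- by apply: (deriv_identities (E `|` G) _ _).1 => // e [/YS'|/ZS'].
Qed.

(** The form in which lower modularity is applied: the conclusion is
    useful when E and G are chosen so that all G-consequences w of u are known. *)
Lemma lower_modular_move V (E G : set identity) u v :
  lower_modular_variety V -> E `<=` identities V ->
  theory V u v -> u <> v -> deriv (E `|` G) u v ->
  (forall w, ~ step E u w) ->
  exists w, [/\ w <> u, theory V u w & deriv G u w].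
Proof.
move=> lmV EV uvV uv uvEG nE.
have /deriv_first/(_ uv) [w] := lower_modular_deriv lmV EV uvV uvEG.
move=> [a [b [f [l [r [lr uE wE]]]]]] wu.
have [lrE|[lrV lrG]] : (E (l, r) \/ E (r, l)) \/
    (theory V (letters l) (letters r) /\ deriv G (letters l) (letters r)).
- by case: lr => -[lr|[/theoryP lr1 /= lr2]];
    [left; left|right|left; right|right; split; exact: deriv_sym].
- by case: (nE w); exists a, b, f, l, r.
by exists w; split=> //; rewrite uE wE; apply: deriv_ctx; apply: deriv_subst.
Qed.

Arguments subst : simpl never.
Arguments letters : simpl never.

(** * Powers of words, and absorption *)

Definition wpow (p : seq nat) (k : nat) : seq nat := flatten (nseq k p).

Lemma wpowS p k : wpow p k.+1 = p ++ wpow p k.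
Proof. by []. Qed.

Lemma wpowD p i j : wpow p (i + j) = wpow p i ++ wpow p j.
Proof. by rewrite /wpow nseqD flatten_cat. Qed.

Lemma wpow1 p : wpow p 1 = p.
Proof. exact: cats0. Qed.

Lemma wpowSr p k : wpow p k.+1 = wpow p k ++ p.
Proof. by rewrite -addn1 wpowD wpow1. Qed.

Lemma wpow_letter x k : wpow [:: x] k = nseq k x.
Proof. by elim: k => //= k <-. Qed.

Lemma size_wpow p k : size (wpow p k) = k * size p.
Proof. by rewrite size_flatten /shape map_nseq sumn_nseq mulnC. Qed.

Lemma mem_wpow p k : 0 < k -> wpow p k =i p.
Proof.
case: k => // k _; elim: k => [|k IH] x; first by rewrite wpow1.
by rewrite wpowS mem_cat IH orbb.
Qed.

Lemma wpow_sub p k : {subset wpow p k <= p}.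
Proof. by case: k => // k x; rewrite mem_wpow. Qed.

Lemma subst_wpow f p k : subst f (wpow p k) = wpow (subst f p) k.
Proof. by elim: k => // k IH; rewrite !wpowS subst_cat IH. Qed.

Lemma deriv_wpow E u v k : deriv E u v -> deriv E (wpow u k) (wpow v k).
Proof.
by move=> uv; elim: k => [|k IH]; [apply: deriv_refl|apply: deriv_cat].
Qed.

Lemma prefix_catl_size (u s t : seq nat) :
  size u <= size s -> prefix u (s ++ t) = prefix u s.
Proof. by move=> us; rewrite !prefixE takel_cat. Qed.

Lemma suffix_catr_size (u s t : seq nat) :
  size u <= size s -> suffix u (t ++ s) = suffix u s.
Proof. by move=> us; rewrite /suffix rev_cat prefix_catl_size ?size_rev. Qed.

(** From p u = u q it follows that u is a prefix of some power of p. *)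
Lemma commuting_prefix_sub (p q u : seq nat) :
  p != [::] -> p ++ u = u ++ q -> {subset u <= p}.
Proof.
move=> p0; have [n] := ubnP (size u); elim: n u => // n IH u un puq x xu.
have [up|pu] := leqP (size u) (size p).
  have : take (size u) (p ++ u) = u by rewrite puq take_size_cat.
  by rewrite takel_cat // => uE; rewrite -uE in xu; apply: mem_take xu.
have : take (size p) (p ++ u) = take (size p) u.
  by rewrite puq takel_cat // ltnW.
rewrite take_size_cat // => pE.
have uE := cat_take_drop (size p) u; rewrite -pE in uE.
move: xu; rewrite -uE mem_cat => /orP[//|]; apply: IH.
  by rewrite size_drop; case: (p) p0 pu un => //= *; lia.
move: puq; rewrite -{1 2}uE -catA => /eqP; rewrite eqseq_cat // eqxx.
by move=> /eqP.
Qed.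

(** Modulo u = uu and v = vv the word u is equal only to words with prefix u, suffix u
    and the letters of u: replacing an instance of u or v by its square, or back,
    affects neither the set of letters nor the prefixes and suffixes of length at
    most that of u.  The identity uu = vv is too long to be applied to u. *)
Lemma lower_modular_absorb V u v :
  lower_modular_variety V -> theory V u v -> u <> v -> size u <= size v ->
  exists2 p, p =i u & theory V u (p ++ u).
Proof.
move=> lmV uvV uv uv_size.
have u0 : u != [::].
  by apply/eqP => u0; rewrite u0 in uvV uv; case: uv; rewrite (deriv_nil uvV).
have v0 : v != [::] by case: (u) (v) u0 uv_size => [|? ?] [].
have uu0 : u ++ u != [::] by case: (u) u0.
have vv0 : v ++ v != [::] by case: (v) v0.
pose E := [set (word_of (u ++ u), word_of (v ++ v))] : set identity.
pose G := [set (word_of u, word_of (u ++ u)); (word_of v, word_of (v ++ v))]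
  : set identity.
have uvEG : deriv (E `|` G) u v.
  apply: (@deriv_trans _ (u ++ u)).
    rewrite -{1}(word_ofK u0) -(word_ofK uu0).
    by apply: (@deriv_axiom _ (_, _)); right; left.
  apply: (@deriv_trans _ (v ++ v)).
    rewrite -(word_ofK uu0) -(word_ofK vv0).
    by apply: (@deriv_axiom _ (_, _)); left.
  apply: deriv_sym; rewrite -{1}(word_ofK v0) -(word_ofK vv0).
  by apply: (@deriv_axiom _ (_, _)); right; right.
have EV : E `<=` identities V.
  move=> _ ->; apply/theoryP; rewrite !word_ofK //; exact: deriv_cat.
have nE w : ~ step E u w.
  move=> [a [b [f [l [r [lr /(congr1 size) uE _]]]]]].
  move: uE; rewrite (size_cat a) (size_cat _ b).
  have := size_subst f (letters l).
  have : size u < size (letters l).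
    by case: lr => -[]; [move=> -> _|move=> _ ->]; rewrite word_ofK // size_cat;
      case: (u) (v) u0 v0 uv_size => [|? ?] [|? ?] //= *; lia.
  by move=> /leq_trans/[apply]; lia.
have [w [wu uwV uwG]] := lower_modular_move lmV EV uvV uv uvEG nE.
have [pre suf con] : [/\ prefix u w, suffix u w & w =i u].
  have GP w1 w2 : step G w1 w2 ->
    [/\ prefix u w1 = prefix u w2, suffix u w1 = suffix u w2 & w1 =i w2].
    have sq a b c : size u <= size c ->
      [/\ prefix u (a ++ c ++ b) = prefix u (a ++ (c ++ c) ++ b),
          suffix u (a ++ c ++ b) = suffix u (a ++ (c ++ c) ++ b) &
          a ++ c ++ b =i a ++ (c ++ c) ++ b].
      move=> uc; have uac : size u <= size (a ++ c) by rewrite size_cat; lia.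
      have ucb : size u <= size (c ++ b) by rewrite size_cat; lia.
      have -> : a ++ (c ++ c) ++ b = (a ++ c) ++ (c ++ b) by rewrite -!catA.
      split; first by rewrite [in LHS]catA !(prefix_catl_size _ uac).
        by rewrite !(suffix_catr_size _ ucb).
      by move=> x; rewrite !mem_cat; case: (x \in a); case: (x \in c).
    have key l r f : G (l, r) ->
        subst f (letters r) = subst f (letters l) ++ subst f (letters l) /\
        size u <= size (subst f (letters l)).
      case=> -[-> ->].
        rewrite (word_ofK u0) (word_ofK uu0) subst_cat; split=> //.
        exact: size_subst.
      rewrite (word_ofK v0) (word_ofK vv0) subst_cat; split=> //.
      exact: leq_trans uv_size (size_subst _ _).
    move=> [a [b [f [l [r [[lr|lr] -> ->]]]]]]; have [-> /sq] := key _ _ f lr.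
      exact.
    by move=> /(_ a b)[-> -> m]; split=> // x; rewrite m.
  have GD w1 w2 : deriv G w1 w2 ->
      [/\ prefix u w1 = prefix u w2, suffix u w1 = suffix u w2 & w1 =i w2].
    elim=> {w1 w2} [//|w1 w2 w3 /GP[-> -> e] _ [-> -> e']]; split=> // x.
    by rewrite e.
  have [<- <- con] := GD _ _ uwG.
  by split; [apply: prefix_refl|apply: suffix_refl|move=> x; rewrite con].
have [q wq] := prefixP pre; have [p wp] := suffixP suf.
have p0 : p != [::] by apply/eqP => p0; apply: wu; rewrite wp p0.
exists p; last by rewrite -wp.
have up := commuting_prefix_sub p0 (etrans (esym wp) wq).
move=> x; apply/idP/idP => [xp|/up//].
by rewrite -con wp mem_cat xp.
Qed.

(** * Exchange of powers *)

(** Substitutions and contexts never shorten, so equality of lengths leaves only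
    substitutions of letters for letters in the empty context. *)
Lemma subst_letterwise f a b l : size (a ++ subst f l ++ b) = size l ->
  exists g : nat -> nat,
    forall r, {subset r <= l} -> a ++ subst f r ++ b = map g r.
Proof.
rewrite (size_cat a) (size_cat _ b) => eqs.
have := size_subst f l => le_s.
have [a0 b0] : a = [::] /\ b = [::].
  by case: (a) (b) eqs => [|? ?] [|? ?] //= ?; lia.
exists (fun x => (f x).1) => r rl; rewrite a0 b0 cats0 /=.
have {eqs a0 b0 a b} : size (subst f l) = size l by lia.
have f1 : size (subst f l) = size l -> {in l, forall x, letters (f x) = [:: (f x).1]}.
  elim: l {le_s rl} => // x s IH; rewrite subst_cons size_cat /=.
  have := size_subst f s => les es y; rewrite inE => /orP[/eqP ->|].
    by move: es; rewrite /letters; case: (f x).2 => //= *; lia.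
  by apply: IH; lia.
move=> /f1 {}f1; elim: r rl => // x r IH rl.
rewrite subst_cons f1 ?rl ?mem_head //= IH // => y yr.
by apply: rl; rewrite inE yr orbT.
Qed.

(** Letter-to-letter images of words with a power of z at one end.  In the two
    crossing lemmas the powers of z stand at opposite ends but are long enough to
    overlap, so g z = z, which contradicts the letter x facing a z.  In the other two
    the powers of z stand at the same end, and the outermost copies of p (or q) and
    the outermost z show that g fixes the letters involved. *)
Section Exchange.
Variables (g : nat -> nat) (z : nat).

Lemma map_cross_left c x X Y n :
  size (x :: Y) < c -> 0 < n -> x != z ->
  map g (nseq c z ++ X) <> x :: Y ++ nseq n z.
Proof.
move=> Yc n0 xz eqg.
have c0 : 0 < c by lia.
have gz : g z = z.
  have := congr1 (nth 0 ^~ (size (x :: Y))) eqg; rewrite map_cat nth_cat size_map.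
  rewrite size_nseq Yc (nth_map 0) ?size_nseq // nth_nseq Yc => ->.
  by rewrite -cat_cons nth_cat ltnn subnn; case: n n0 {eqg}.
by case: c c0 eqg {Yc} => //= c _ []; rewrite gz => /esym/eqP; rewrite (negPf xz).
Qed.

Lemma last_cat_nseq y T n : 0 < n -> last y (T ++ nseq n z) = z.
Proof. by case: n => // n _; rewrite last_cat -[n.+1]addn1 nseqD last_cat. Qed.

Lemma map_cross_right c x X Y n :
  size Y < c -> 0 < n -> x != z ->
  map g (Y ++ nseq n z) <> nseq c z ++ rcons X x.
Proof.
move=> Yc n0 xz eqg.
have gz : g z = z.
  have := congr1 (nth 0 ^~ (size Y)) eqg; rewrite map_cat nth_cat size_map ltnn.
  rewrite subnn nth_cat size_nseq Yc nth_nseq Yc.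
  by case: n n0 {eqg}.
have := congr1 (last (g z)) eqg; rewrite last_map -rcons_cat last_rcons.
by rewrite last_cat_nseq // gz => /esym/eqP; rewrite (negPf xz).
Qed.

Lemma map_fix_left p k k' n n' : 0 < n -> 0 < n' ->
  map g (wpow p k.+1 ++ nseq n z) = wpow p k'.+1 ++ nseq n' z ->
  g z = z /\ map g p = p.
Proof.
move=> n0 n0' eqg; split.
  by have := congr1 (last (g z)) eqg; rewrite last_map !last_cat_nseq.
have := congr1 (take (size p)) eqg.
by rewrite !wpowS -!catA map_cat !take_size_cat ?size_map.
Qed.

Lemma map_fix_right q k k' n n' : 0 < n -> 0 < n' ->
  map g (nseq n z ++ wpow q k.+1) = nseq n' z ++ wpow q k'.+1 ->
  g z = z /\ map g q = q.
Proof.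
move=> n0 n0' eqg; split.
  by case: n n' n0 n0' eqg => // n [] // n' _ _ [].
have := congr1 (take (size q) \o rev) eqg => /=.
rewrite !wpowSr !map_cat !rev_cat -!catA !take_size_cat ?size_rev ?size_map //.
by move=> /(can_inj revK).
Qed.

End Exchange.

Lemma step_letterwise (H : set identity) (C w1 w2 : seq nat) :
  (forall l r, H (l, r) -> [/\ size (letters l) = size w1,
     size (letters r) = size w1, letters l =i C & letters r =i C]) ->
  step H w1 w2 -> exists g l r,
    [/\ H (l, r) \/ H (r, l), w1 = map g (letters l) & w2 = map g (letters r)].
Proof.
move=> HC [a [b [f [l [r [lr w1E w2E]]]]]].
have [sl lC rC] : [/\ size (letters l) = size w1, letters l =i C & letters r =i C].
  by case: lr => /HC[].
have [|g gE] := @subst_letterwise f a b (letters l); first by rewrite -w1E.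
exists g, l, r; split=> //; first by rewrite w1E gE.
by rewrite w2E gE // => x; rewrite rC lC.
Qed.

Lemma theory_period V m d p k j :
  theory V (nseq m 0) (nseq (m + d) 0) -> m <= k ->
  theory V (wpow p k) (wpow p (k + d * j)).
Proof.
move=> per mk.
have [->|p0] := eqVneq p [::].
  suff nil i : wpow [::] i = [::] by rewrite !nil; apply: deriv_refl.
  by elim: i.
have per1 : theory V (wpow p m) (wpow p (m + d)).
  have := deriv_subst (fun=> word_of p) per.
  by rewrite -!wpow_letter !subst_wpow subst1 word_ofK.
elim: j => [|j IH]; first by rewrite muln0 addn0; apply: deriv_refl.
apply: deriv_trans IH _; rewrite mulnS.
have -> : k + d * j = m + (k + d * j - m) by lia.
have -> : k + (d + d * j) = m + d + (k + d * j - m) by lia.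
by rewrite (wpowD p m) (wpowD p (m + d)); apply: deriv_cat per1 (deriv_refl _).
Qed.

(** The companion v of u = p^a z^b trades |p| d letters z for d copies of p; likewise
    s' trades d copies of q in s for letters z.  The exponent of z in s exceeds the
    length of p^(a+d), so that the powers of z in u, v overlap those in s, s'; the
    equation between a and e makes u and s equally long. *)
Lemma lower_modular_exchange V (p q : seq nat) (z m d : nat) :
  lower_modular_variety V -> 0 < m -> 0 < d ->
  theory V (nseq m 0) (nseq (m + d) 0) ->
  p != [::] -> p =i q -> z \notin p ->
  exists a b e, [/\ m <= a, m <= b, m <= e, a * size p = size p + e * size q &
    theory V (wpow p a ++ nseq b z) (nseq (b + size p) z ++ wpow q e)].
Proof.
move=> lmV m0 d0 per p0 pq zp.
have zq : z \notin q by rewrite -pq.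
have q0 : q != [::].
  by case: (p) p0 pq => // x ? _ /(_ x); rewrite mem_head; case: (q).
have sp : 0 < size p by case: (p) p0.
have sq : 0 < size q by case: (q) q0.
(* The multiples of size p and size q solve the length equation
   a * size p = size p + e * size q. *)
pose a := (size q * (m + d)).+1.
pose e' := size p * (m + d) - d.
have e'm : m <= e' by rewrite /e'; nia.
have e'd : e' + d = size p * (m + d) by rewrite /e'; nia.
pose b' := m + (a + d) * size p - d * size p.
have b'm : m <= b' by rewrite /b'; nia.
pose b := b' + d * size p.
have bE : b = m + (a + d) * size p by rewrite /b /b'; nia.
pose c := b + size p.
pose u := wpow p a ++ nseq b z.
pose v := wpow p (a + d) ++ nseq b' z.
pose s := nseq c z ++ wpow q (e' + d).
pose s' := nseq (c + d * size q) z ++ wpow q e'.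
have am : m <= a by rewrite /a; nia.
have len : a * size p = size p + (e' + d) * size q by rewrite e'd /a; nia.
exists a, b, (e' + d); split=> //; [lia|lia|].
have szu : size u = a * size p + b by rewrite size_cat size_wpow size_nseq.
have szv : size v = a * size p + b.
  by rewrite size_cat size_wpow size_nseq /b; lia.
have szs : size s = a * size p + b.
  by rewrite size_cat size_wpow size_nseq len /c; lia.
have szs' : size s' = a * size p + b.
  by rewrite size_cat size_wpow size_nseq len /c; lia.
have ne (w : seq nat) : size w = a * size p + b -> w != [::].
  by case: w => //= ?; lia.
have left_in x y : 0 < x -> 0 < y -> wpow p x ++ nseq y z =i z :: p.
  by move=> x0 y0 t; rewrite mem_cat mem_wpow // mem_nseq y0 inE orbC.
have right_in x y : 0 < x -> 0 < y -> nseq y z ++ wpow q x =i z :: p.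
  by move=> x0 y0 t; rewrite mem_cat mem_wpow // mem_nseq y0 inE pq.
have uC : u =i z :: p by apply: left_in; lia.
have vC : v =i z :: p by apply: left_in; lia.
have sC : s =i z :: p by apply: right_in; lia.
have sC' : s' =i z :: p by apply: right_in; lia.
have uK := word_ofK (ne u szu); have vK := word_ofK (ne v szv).
have sK := word_ofK (ne s szs); have sK' := word_ofK (ne s' szs').
have fix_all g : map g p = p -> g z = z ->
    [/\ map g u = u, map g v = v, map g s = s & map g s' = s'].
  move=> gp gz.
  have gid w : w =i z :: p -> map g w = w.
    move=> wC; rewrite -[RHS]map_id; apply/eq_in_map => x; rewrite wC inE.
    move=> /orP[/eqP->//|xp]; move: gp; rewrite -[RHS]map_id => /eq_in_map; exact.
  by split; apply: gid.
have gq g : map g q = q -> map g p = p.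
  rewrite -{2}[q]map_id -{2}[p]map_id => /eq_in_map gq; apply/eq_in_map => x.
  by rewrite pq; apply: gq.
have lt_ac k : k <= a + d -> k * size p < c by move=> ka; rewrite /c bE; nia.
have dq0 : 0 < d * size q by rewrite muln_gt0 d0 sq.
have c0 : 0 < c by rewrite /c; lia.
have b0 : 0 < b by rewrite bE; lia.
(* The set {u, s} is closed under G: a letter-to-letter map sending u to u or s to s
   fixes all letters, and none sends v, s or s' to u, or u, v or s' to s. *)
have u_to_u g : map g u = u -> map g s = s.
  move=> /map_fix_left[]; [lia|lia|move=> gz gp].
  by have [] := fix_all g gp gz.
have v_to_u g : map g v <> u.
  move=> gvu; have := gvu; rewrite /v /u /a addSn => /map_fix_left[]; [lia|lia|].
  move=> gz gp; have [_ gv _ _] := fix_all g gp gz.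
  have : nth 0 u (a * size p) = nth 0 v (a * size p) by rewrite -gvu gv.
  rewrite (nth_cat _ (wpow p a)) (nth_cat _ (wpow p (a + d))) !size_wpow ltnn subnn.
  rewrite ltn_pmul2r // [in RHS]ifT; last lia.
  rewrite nth_nseq ifT => [zE|]; last lia.
  have /wpow_sub : nth 0 (wpow p (a + d)) (a * size p) \in wpow p (a + d).
    by rewrite mem_nth // size_wpow ltn_pmul2r //; lia.
  by rewrite -zE (negPf zp).
have s_to_s g : map g s = s -> map g u = u.
  rewrite /s addnC; case: (d) d0 => // d1 _; rewrite addSn.
  move=> /map_fix_right[]; [lia|lia|move=> gz /gq gp].
  by have [] := fix_all g gp gz.
have s'_to_s g : map g s' <> s.
  move=> gs's; have := gs's; rewrite /s' /s.
  case: (d) (e') d0 e'm => // d1 [|e1] _; first lia.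
  rewrite addSn => _ /map_fix_right[]; [lia|lia|].
  move=> gz /gq gp; have [_ _ _ gs'] := fix_all g gp gz.
  have : nth 0 s c = nth 0 s' c by rewrite -gs's gs'.
  rewrite (nth_cat _ (nseq c z)) (nth_cat _ (nseq (c + _) z)) !size_nseq ltnn subnn.
  rewrite [in RHS]ifT; last lia.
  rewrite nth_nseq ifT => [zE|]; last lia.
  have /wpow_sub : nth 0 (wpow q (e' + d)) 0 \in wpow q (e' + d).
    by rewrite mem_nth // size_wpow; lia.
  by rewrite zE (negPf zq).
have ap0 : 0 < a * size p by rewrite muln_gt0 sp andbT.
have eq0 : 0 < (e' + d) * size q by rewrite muln_gt0 sq; lia.
have cross_u g l : l = s \/ l = s' -> map g l <> u.
  have [x [Y uE]] : exists x Y, wpow p a = x :: Y.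
    case pE: (wpow p a) => [|x Y]; last by exists x, Y.
    by move: ap0; rewrite -size_wpow pE.
  have xz : x != z.
    by apply: contraNneq zp => <-; apply: (@wpow_sub p a); rewrite uE mem_head.
  have Ys : size (x :: Y) < c by rewrite -uE size_wpow; apply: lt_ac; lia.
  by case=> ->; rewrite /u uE; apply: map_cross_left => //;
    apply: leq_trans Ys (leq_addr _ _).
have cross_s g l : l = u \/ l = v -> map g l <> s.
  have [X [x sE]] : exists X x, wpow q (e' + d) = rcons X x.
    case/lastP qE: (wpow q (e' + d)) => [|X x]; last by exists X, x.
    by move: eq0; rewrite -size_wpow qE.
  have xz : x != z.
    apply: contraNneq zq => <-; apply: (@wpow_sub q (e' + d)).
    by rewrite sE mem_rcons mem_head.
  by case=> ->; rewrite /s sE; apply: map_cross_right; rewrite ?size_wpow ?lt_ac //; lia.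
pose E := [set (word_of s, word_of s')] : set identity.
pose G := [set (word_of u, word_of s); (word_of v, word_of s')] : set identity.
have nE w : ~ step E u w.
  move=> /(@step_letterwise E (z :: p)) [l r|g [l [r [lr uE _]]]].
    by case=> -> ->; rewrite sK sK' szu.
  apply: (@cross_u g (letters l)) (esym uE).
  by case: lr => -[]; [move=> -> _; left|move=> _ ->; right].
have GP w1 w2 : step G w1 w2 -> w1 = u \/ w1 = s -> w2 = u \/ w2 = s.
  move=> sw w1us; have szw : size w1 = a * size p + b by case: w1us => ->.
  have [l r|g [l [r [lr w1E w2E]]]] := @step_letterwise G (z :: p) _ _ _ sw.
    by rewrite szw; case=> -[-> ->]; rewrite ?uK ?vK ?sK ?sK'.
  rewrite w2E; move: w1us; rewrite w1E.
  case: lr => -[] [-> ->]; rewrite ?uK ?vK ?sK ?sK' => -[].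
  - by move=> /u_to_u ->; right.
  - by move=> /cross_s []; left.
  - by move=> /v_to_u.
  - by move=> /cross_s []; right.
  - by move=> /cross_u []; left.
  - by move=> /s_to_s ->; left.
  - by move=> /cross_u []; right.
  - by move=> /s'_to_s.
have GD w1 w2 : deriv G w1 w2 -> w1 = u \/ w1 = s -> w2 = u \/ w2 = s.
  by elim=> {w1 w2} [//|w1 w2 w3 /GP s12 _ IH /s12].
have uvV : theory V u v.
  rewrite /u /v /b; apply: deriv_cat.
    by have := theory_period p 1 per am; rewrite muln1.
  by rewrite -!wpow_letter; apply: deriv_sym (theory_period _ _ per b'm).
have EV : E `<=` identities V.
  move=> _ ->; apply/theoryP; rewrite sK sK'; apply: deriv_cat.
    by rewrite -!wpow_letter; apply: theory_period per _; rewrite /c; lia.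
  by have := theory_period q 1 per e'm; rewrite muln1 => /deriv_sym.
have uv : u <> v by move=> uv; apply: (v_to_u id); rewrite map_id.
have uvEG : deriv (E `|` G) u v.
  rewrite -uK -vK; apply: deriv_trans (deriv_trans (v := letters (word_of s')) _ _).
  - by apply: (@deriv_axiom _ (_, _)); right; left.
  - by apply: (@deriv_axiom _ (_, _)); left.
  - by apply: deriv_sym; apply: (@deriv_axiom _ (_, _)); right; right.
have [w [wu uwV /GD]] := lower_modular_move lmV EV uvV uv uvEG nE.
by case=> [|//|ws]; [left|rewrite -[X in theory V _ X]ws].
Qed.

Lemma subst_const w s : subst (fun=> w) s = wpow (letters w) (size s).
Proof. by elim: s => // x s IH; rewrite subst_cons IH. Qed.

Lemma subst_fix f s : {in s, forall x, f x = (x, [::])} -> subst f s = s.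
Proof.
elim: s => // x s IH fs; rewrite subst_cons fs ?mem_head // IH // => y ys.
by apply: fs; rewrite inE ys orbT.
Qed.

Lemma fresh_letter (s : seq nat) : exists z, z \notin s.
Proof.
exists (sumn s).+1; apply/negP => /(nthP 0)[i si iE].
suff: nth 0 s i <= sumn s by rewrite iE ltnn.
elim: s i si {iE} => // x s IH [|i] /= si; first exact: leq_addr.
exact: leq_trans (IH i si) (leq_addl _ _).
Qed.

Lemma lower_modular_periodic V u v :
  lower_modular_variety V -> theory V u v -> u <> v ->
  exists m d, [/\ 0 < m, 0 < d & theory V (nseq m 0) (nseq (m + d) 0)].
Proof.
move=> lmV; wlog uv_size : u v / size u <= size v => [wh|] uvV uv.
  have [le|/ltnW le] := leqP (size u) (size v); first exact: (wh u v).
  by apply: (wh v u) => //; [apply: deriv_sym|apply/nesym].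
have [p pu puV] := lower_modular_absorb lmV uvV uv uv_size.
have u0 : u != [::].
  by apply/eqP => u0; rewrite u0 in uvV uv; case: uv; rewrite (deriv_nil uvV).
have p0 : p != [::].
  by apply: contraNneq u0 => p0; case: (u) pu => // x s /(_ x); rewrite p0 mem_head.
exists (size u), (size p); split; [by case: (u) u0|by case: (p) p0|].
have := deriv_subst (fun=> (0, [::])) puV.
by rewrite !subst_const !wpow_letter size_cat addnC.
Qed.

(** Exchange with p = q = x relates x^a z^b to z^(b+1) x^e where a = e + 1.
    Replacing z by x^d yields powers of x whose exponents differ by d - 1, which
    together with period d leaves period 1. *)
Lemma lower_modular_aperiodic V u v :
  lower_modular_variety V -> theory V u v -> u <> v ->
  exists2 m, 0 < m & theory V (nseq m 0) (nseq (m + 1) 0).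
Proof.
move=> lmV uvV uv.
have [m [d [m0 d0 per]]] := lower_modular_periodic lmV uvV uv.
have [a [b [e [am bm em ae abV]]]] := @lower_modular_exchange V [:: 0] [:: 0] 1 m d
  lmV m0 d0 per isT (fun=> erefl) isT.
have {}abV := deriv_subst (fun x => if x == 1 then (0, nseq d.-1 0) else (0, [::])) abV.
exists (e + b * d); first lia.
have lenE k i : wpow (letters (0, nseq d.-1 0)) k ++ nseq i 0 = nseq (k * d + i) 0.
  rewrite nseqD; congr (_ ++ _); have -> : letters (0, nseq d.-1 0) = nseq d 0.
    by rewrite -[in RHS](prednK d0).
  by elim: k => // k IH; rewrite wpowS IH -nseqD mulSn.
have lenE' k i : nseq i 0 ++ wpow (letters (0, nseq d.-1 0)) k = nseq (i + k * d) 0.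
  by rewrite -[wpow _ _]cats0 (lenE k 0) addn0 -nseqD.
move: abV; rewrite -[nseq b 1]wpow_letter -[nseq (b + _) 1]wpow_letter !subst_cat.
rewrite !subst_wpow !subst1 /= [letters (0, [::])]/(letters _) !wpow_letter.
rewrite lenE lenE' => abV.
have per' : theory V (nseq (e + b * d) 0) (nseq (e + b * d + d) 0).
  have := @theory_period V m d [:: 0] (e + b * d) 1 per.
  by rewrite muln1 !wpow_letter; apply; lia.
apply: deriv_trans per' _.
have -> : e + b * d + d = (b + size [:: 0]) * d + e by rewrite /=; lia.
have -> : e + b * d + 1 = a + b * d by move: ae => /=; lia.
exact: deriv_sym.
Qed.

(** With period 1 all sufficiently large exponents are equivalent, and exchange reads
    p^m z^m = z^m q^m with z new.  Substituting p for z gives p^m = p^m q^m, and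
    substituting q for z gives p^m q^m = q^m. *)
Lemma lower_modular_power V u v :
  lower_modular_variety V -> theory V u v -> u <> v ->
  exists2 M, 1 < M & (forall p, theory V (wpow p M) (wpow p M.+1)) /\
    forall p q, p =i q -> theory V (wpow p M) (wpow q M).
Proof.
move=> lmV uvV uv; have [m m0 per] := lower_modular_aperiodic lmV uvV uv.
have perk p k j : m <= k -> theory V (wpow p k) (wpow p (k + j)).
  by move=> mk; have := theory_period p j per mk; rewrite mul1n.
exists m.+1 => //; split=> [p|p q pq].
  by have := perk p m.+1 1 (leqnSn m); rewrite addn1.
have [p0|p0] := eqVneq p [::].
  suff -> : q = p by apply: deriv_refl.
  by rewrite p0; case: (q) pq => // x s /(_ x); rewrite p0 mem_head.
have q0 : q != [::].
  by case: (p) p0 pq => // x ? _ /(_ x); rewrite mem_head; case: (q).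
have [z zp] := fresh_letter p; have zq : z \notin q by rewrite -pq.
have [a [b [e [am bm em _ abV]]]] :=
  lower_modular_exchange lmV m0 (ltn0Sn 0) per p0 pq zp.
pose f w x : word := if x == z then word_of w else (x, [::]).
have fp w r : z \notin r -> subst (f w) r = r.
  move=> zr; apply: subst_fix => x xr; rewrite /f; case: eqP => // xz.
  by rewrite -xz xr in zr.
have fz w k : w != [::] -> subst (f w) (nseq k z) = wpow w k.
  by move=> w0; rewrite -wpow_letter subst_wpow subst1 /f eqxx word_ofK.
have norm w k : m <= k -> theory V (wpow w k) (wpow w m).
  by move=> mk; have := perk w m (k - m) (leqnn m); rewrite subnKC // => /deriv_sym.
have perm w : theory V (wpow w m.+1) (wpow w m) by apply: norm.
apply: deriv_trans (perm p) _; apply: deriv_sym; apply: deriv_trans (perm q) _.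
have mix w k r j : m <= k -> m <= j ->
    theory V (wpow w k ++ wpow r j) (wpow w m ++ wpow r m).
  by move=> mk mj; apply: deriv_cat; apply: norm.
have := deriv_subst (f p) abV.
rewrite !subst_cat !subst_wpow (fp _ _ zp) (fp _ _ zq) !fz // -wpowD => pV.
have := deriv_subst (f q) abV.
rewrite !subst_cat !subst_wpow (fp _ _ zp) (fp _ _ zq) !fz // -wpowD => qV.
have {}pV : theory V (wpow p m) (wpow p m ++ wpow q m).
  apply: deriv_trans (deriv_sym (norm p (a + b) _)) _; first lia.
  by apply: deriv_trans pV _; apply: mix => //; lia.
have {}qV : theory V (wpow p m ++ wpow q m) (wpow q m).
  apply: deriv_trans (deriv_sym (mix p a q b am bm)) _.
  by apply: deriv_trans qV _; apply: norm; lia.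
by apply: deriv_sym; apply: deriv_trans pV qV.
Qed.

(** If p has the letters of u and u = pu, then u = p^M u, and p^M absorbs u: the powers
    p^M and (pu)^M are equal since pu has the same letters as p, while
    (pu)^M = (pu)^M pu = p^M u. *)
Lemma lower_modular_shape V : lower_modular_variety V ->
  (forall u v, theory V u v -> u = v) \/
  exists M, [/\ 1 < M,
    forall p q, p =i q -> theory V (wpow p M) (wpow q M) &
    forall u v, theory V u v -> u <> v -> theory V u (wpow u M)].
Proof.
move=> lmV; have [triv|] := EM (forall u v, theory V u v -> u = v); first by left.
move=> /existsNP[u0 /existsNP[v0 /not_implyP[uv0 nuv0]]]; right.
have [M M1 [perM conM]] := lower_modular_power lmV uv0 nuv0.
exists M; split=> // u v.
wlog uv_size : u v / size u <= size v => [wh|] uvV uv.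
  have [le|/ltnW le] := leqP (size u) (size v); first exact: (wh u v).
  have vM := wh _ _ le (deriv_sym uvV) (nesym uv).
  exact: deriv_trans (deriv_trans uvV vM) (deriv_sym (deriv_wpow M uvV)).
have [p pu puV] := lower_modular_absorb lmV uvV uv uv_size.
have pkV k : theory V u (wpow p k ++ u).
  elim: k => [|k IH]; first exact: deriv_refl.
  by apply: deriv_trans puV _; rewrite wpowS -catA; apply: deriv_cat (deriv_refl _) IH.
apply: deriv_trans (pkV M.+1) _; apply: deriv_trans _ (conM _ _ pu).
have qp : p ++ u =i p by move=> x; rewrite mem_cat -pu orbb.
rewrite wpowSr -catA; apply: deriv_trans _ (conM _ _ qp).
apply: deriv_trans _ (deriv_sym (perM _)); rewrite wpowSr.
by apply: deriv_cat (deriv_refl _); apply: conM => x; rewrite qp.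
Qed.

(** * Modularity *)

(** One inclusion of the modular law holds in every lattice; the other one, read on
    theories, concerns the identities of Y derivable from those of V and Z. *)
Lemma modular_varietyP (V : semigroup_variety) :
  (forall Y Z : semigroup_variety,
     (forall u v, theory Z u v -> theory Y u v) -> forall u v, theory Y u v ->
     deriv (identities V `|` identities Z) u v ->
     deriv ((identities V `&` identities Y) `|` identities Z) u v) ->
  modular_variety V.
Proof.
move=> der Y Z YZ; apply/le_anti/andP; split; last first.
  rewrite leUx !lexI leIr YZ leUr !andbT.
  by rewrite (le_trans (leIl V Z)) // leUl.
apply/variety_leP => S [SVY SZ].
suff: variety_class (variety_join (variety_meet V Z) Y) S by [].
move=> -[l r] lr.
have ZY u v : theory Z u v -> theory Y u v.
  apply: deriv_sub => -[l' r'] /= lr'; apply/theoryP => S' YS'; apply: lr'.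
  by move/variety_leP: YZ; apply.
have lrY : theory Y (letters l) (letters r).
  by apply/theoryP => S' YS'; apply: lr; right.
have lrVZ : deriv (identities V `|` identities Z) (letters l) (letters r).
  apply: deriv_complete => S' S'VZ; apply: lr; left; split.
    by rewrite variety_modelsE => e Ve; apply: S'VZ; left.
  by rewrite variety_modelsE => e Ze; apply: S'VZ; right.
apply: (deriv_identities _ _ _).1 (der Y Z ZY _ _ lrY lrVZ) _ _ => e [[Ve Ye]|Ze].
  by apply: SVY => S' [VS'|YS']; [apply: Ve|apply: Ye].
exact: Ze.
Qed.

(** An identity u = v in which some letter x occurs only in v becomes, on replacing
    every other letter by p and x by pq, an identity that turns a power of p into a
    word with the factor q. *)
Lemma nonregular_factor (E : set identity) u v : deriv E u v -> ~ (u =i v) ->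
  exists2 i, 0 < i & forall p q, p != [::] -> exists A B,
    deriv E (wpow p i) (A ++ q ++ B) /\ A ++ q ++ B =i p ++ q.
Proof.
move=> uvE; wlog [x xv xu] : u v uvE / exists2 x, x \in v & x \notin u.
  move=> wh nuv; have [[x xv xu]|nx] := EM (exists2 x, x \in v & x \notin u).
    by apply: (wh u v) => //; exists x.
  have [[x xv xu]|ny] := EM (exists2 x, x \in u & x \notin v).
    apply: (wh v u); [exact: deriv_sym|by exists x|].
    by move=> e; rewrite e xv in xu.
  case: nuv => x; apply/idP/idP => xI; apply: contrapT => /negP xJ.
    by apply: ny; exists x.
  by apply: nx; exists x.
move=> _; exists (size u).
  by case: (u) uvE xv => // /deriv_nil ->.
move=> p q p0; pose f y := word_of (if y == x then p ++ q else p).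
have pq0 : p ++ q != [::] by case: (p) p0.
have fu : subst f u = wpow p (size u).
  elim: {uvE} u xu => // y u IH; rewrite inE negb_or eq_sym => /andP[yx xu].
  by rewrite subst_cons IH // /f (negPf yx) word_ofK.
have fpq y : {subset subst f [:: y] <= p ++ q}.
  move=> t; rewrite subst1 /f; case: eqP => _; rewrite word_ofK //.
  by rewrite mem_cat => ->.
have := deriv_subst f uvE; rewrite fu => fuv.
have vpq : {subset subst f v <= p ++ q}.
  by move=> t /mem_subst[y _ ty]; apply: (fpq y); rewrite subst1.
have fx : letters (f x) = p ++ q by rewrite /f eqxx word_ofK.
case/splitPr: xv fuv vpq => v1 v2; rewrite subst_cat subst_cons fx -!catA => fuv vpq.
exists (subst f v1 ++ p), (subst f v2); rewrite -catA; split=> // t.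
apply/idP/idP => [|]; first exact: vpq.
by rewrite !mem_cat => /orP[]->; rewrite ?orbT.
Qed.

Section ShapeModular.
Variables (V : semigroup_variety) (M : nat).
Hypothesis M1 : 1 < M.
Hypothesis powV : forall p q, p =i q -> theory V (wpow p M) (wpow q M).
Hypothesis fullV : forall u v, theory V u v -> u <> v -> theory V u (wpow u M).

Let full u := theory V u (wpow u M).

Lemma full_content u v : full u -> full v -> u =i v -> theory V u v.
Proof.
move=> uM vM uv; apply: deriv_trans uM _; apply: deriv_trans (powV uv) _.
exact: deriv_sym.
Qed.

Lemma full_ideal a u b : u != [::] -> full u -> full (a ++ u ++ b).
Proof.
move=> u0 uM; apply: (@fullV _ (a ++ wpow u M ++ b)); first exact: deriv_ctx.
move=> /(congr1 size); rewrite !size_cat size_wpow.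
by case: (u) u0 => //= *; nia.
Qed.

Lemma full_subst f u : full u -> full (subst f u).
Proof. by move=> /(deriv_subst f); rewrite subst_wpow. Qed.

(** By [nonregular_factor] some power of p can be rewritten into a word with the
    letters of pq; so p^M and, likewise, q^M are equal to (pq)^M. *)
Lemma full_nonregular : (exists u v, theory V u v /\ ~ (u =i v)) ->
  forall p q, p != [::] -> q != [::] -> full p -> full q -> theory V p q.
Proof.
move=> [u [v [uvV nuv]]] p q p0 q0 pM qM.
have [i i0 fac] := nonregular_factor uvV nuv.
have grow p' q' : p' != [::] -> theory V (wpow p' M) (wpow (p' ++ q') M).
  move=> p0'; have [A [B [AB con]]] := fac p' q' p0'.
  apply: deriv_trans _ (powV con); apply: deriv_trans _ (deriv_wpow M AB).
  by apply: powV => x; rewrite mem_wpow.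
apply: deriv_trans pM _; apply: deriv_sym; apply: deriv_trans qM _.
apply: deriv_trans (grow q p q0) _; apply: deriv_sym.
apply: deriv_trans (grow p q p0) _.
by apply: powV => x; rewrite !mem_cat orbC.
Qed.

Variables Y Z : semigroup_variety.
Hypothesis ZY : forall u v, theory Z u v -> theory Y u v.

(** The theory of the meet of V \/ Y with Z. *)
Let VYZ := deriv ((identities V `&` identities Y) `|` identities Z).

Lemma VYZ_of_Z u v : theory Z u v -> VYZ u v.
Proof. by apply: deriv_sub => e Ze; apply: deriv_axiom; right. Qed.

Lemma VYZ_of_VY u v : theory V u v -> theory Y u v -> VYZ u v.
Proof.
have [->|/word_ofK <-] := eqVneq u [::].
  by move=> /deriv_nil ->; [move=> _; apply: deriv_refl|].
have [->|/word_ofK <-] := eqVneq v [::].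
  by move=> /deriv_sym/deriv_nil ->; [move=> _; apply: deriv_refl|].
move=> /theoryP uvV /theoryP uvY; by apply: (@deriv_axiom _ (_, _)); left.
Qed.

Lemma VYZ_sub_Y u v : VYZ u v -> theory Y u v.
Proof.
apply: deriv_sub => -[l r] [[_ lrY]|/theoryP lrZ]; first exact/theoryP.
exact: ZY.
Qed.

(** If q has letters outside p, replacing all of them by p^i turns q into a word with
    the letters of p and a factor p^i, and turns p = q into an identity of Y between
    full words with the same letters, hence an identity of both V and Y.  The
    identities of Z then replace that factor p^i by a word with the factor q. *)
Lemma full_extend p q i : 0 < i ->
  (forall p q, p != [::] -> exists A B,
    theory Z (wpow p i) (A ++ q ++ B) /\ A ++ q ++ B =i p ++ q) ->
  p != [::] -> q != [::] -> full p -> full q -> theory Y p q ->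
  exists r, [/\ VYZ p r, full r & r =i p ++ q].
Proof.
move=> i0 fac p0 q0 pM qM pqY.
have [qp|/allPn[t tq tp]] := boolP (all (mem p) q).
  exists p; split=> //; first exact: deriv_refl.
  by move=> x; rewrite mem_cat; apply/idP/orP => [|[//|/(allP qp)//]]; left.
have {}tp : t \notin p by [].
pose f x : word := if x \in p then (x, [::]) else word_of (wpow p i).
have fp : subst f p = p by apply: subst_fix => x; rewrite /f => ->.
have pi0 : wpow p i != [::] by case: (i) (p) i0 p0 => // k [].
have fcon s : {subset subst f s <= p}.
  move=> x /mem_subst[y _]; rewrite /f; case: ifP => yp.
    by rewrite inE => /eqP->.
  by rewrite word_ofK // mem_wpow.
have pfq : theory Y p (subst f q) by rewrite -{1}fp; apply: deriv_subst.
have [q1 [q2 qE]] : exists q1 q2, subst f q = q1 ++ wpow p i ++ q2.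
  case/splitPr: tq => q1 q2; exists (subst f q1), (subst f q2).
  by rewrite subst_cat subst_cons {2}/f (negPf tp) word_ofK.
have fqp : p =i subst f q.
  move=> x; apply/idP/idP => [xp|/fcon//].
  by rewrite qE !mem_cat mem_wpow // xp orbT.
have [A [B [AB con]]] := fac p q p0.
have q12p x : (x \in q1) || (x \in q2) -> x \in p.
  by move=> xq; apply: (fcon q); rewrite qE !mem_cat orbCA xq orbT.
exists (q1 ++ (A ++ q ++ B) ++ q2); split.
- apply: (@deriv_trans _ (subst f q)).
    by apply: VYZ_of_VY => //; apply: full_content => //; apply: full_subst.
  by rewrite qE; apply: VYZ_of_Z; apply: deriv_ctx.
- by rewrite -!catA catA; apply: full_ideal.
- move=> x; have := @q12p x; have := con x; rewrite !mem_cat => ->.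
  case: (x \in p) => [_|]; first by rewrite !orbT.
  case: (x \in q1) => [/(_ isT)|]; first by [].
  by case: (x \in q2) => [/(_ isT)|_] //; rewrite orbF.
Qed.

(** In a derivation from V and Z, p is the source of the first nontrivial step that
    uses V and q is the target of the last one. *)
Lemma join_chain u v : deriv (identities V `|` identities Z) u v ->
  theory Z u v \/ exists p q, [/\ theory Z u p, theory Z q v, full p, full q &
    (forall x y, theory V x y -> x =i y) -> (forall x y, theory Z x y -> x =i y) ->
    p =i q].
Proof.
elim=> {u v} [w|w1 w2 w3 s12 _ IH]; first by left; apply: deriv_refl.
have [s|s] : theory V w1 w2 \/ theory Z w1 w2.
- case: s12 => [a [b [f [l [r [lr -> ->]]]]]].
  have [lrV|lrZ] : theory V (letters l) (letters r) \/ theory Z (letters l) (letters r).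
  + case: lr => -[] /theoryP lr; [by left|by right| |].
      by left; apply: deriv_sym.
    by right; apply: deriv_sym.
  + by left; apply: deriv_ctx; apply: deriv_subst.
  + by right; apply: deriv_ctx; apply: deriv_subst.
- have [e12|n12] := EM (w1 = w2); first by rewrite e12.
  have f1 := fullV s n12; have f2 := fullV (deriv_sym s) (nesym n12).
  case: IH => [w23|[p [q [w2p qw3 fp fq pq]]]]; right.
    exists w1, w2; split=> //; first exact: deriv_refl.
    by move=> rV _; apply: rV.
  exists w1, q; split=> //; first exact: deriv_refl.
  by move=> rV rZ x; rewrite (rV _ _ s) (rZ _ _ w2p) pq.
- case: IH => [w23|[p [q [w2p qw3 fp fq pq]]]]; [left|right].
    exact: deriv_trans s w23.
  by exists p, q; split=> //; apply: deriv_trans s w2p.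
Qed.

Lemma shape_modular u v : theory Y u v ->
  deriv (identities V `|` identities Z) u v -> VYZ u v.
Proof.
move=> uvY uvVZ.
have [u0|u0] := eqVneq u [::].
  by rewrite (deriv_nil uvVZ u0) u0; apply: deriv_refl.
case: (join_chain uvVZ) => [|[p [q [up qv fp fq pq]]]]; first exact: VYZ_of_Z.
suff pqD : VYZ p q.
  exact: deriv_trans (VYZ_of_Z up) (deriv_trans pqD (VYZ_of_Z qv)).
have pqY : theory Y p q.
  apply: deriv_trans (deriv_sym (ZY up)) _.
  exact: deriv_trans uvY (deriv_sym (ZY qv)).
have p0 : p != [::].
  by apply: contra_neq u0 => p0; apply: deriv_nil (deriv_sym up) p0.
have q0 : q != [::].
  by apply: contra_neq p0 => q0; apply: deriv_nil (deriv_sym pqY) q0.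
have nonreg (X : semigroup_variety) : (forall x y, theory X x y -> x =i y) \/
    exists x y, theory X x y /\ ~ (x =i y).
  have [|] := EM (forall x y, theory X x y -> x =i y); first by left.
  by move=> /existsNP[x /existsNP[y /not_implyP[xy nxy]]]; right; exists x, y.
have [rV|nV] := nonreg V; last by apply: VYZ_of_VY => //; apply: full_nonregular.
have [rZ|[x [y [xyZ nxy]]]] := nonreg Z.
  by apply: VYZ_of_VY => //; apply: full_content => //; apply: pq.
have [i i0 fac] := nonregular_factor xyZ nxy.
have [p' [pD fp' pE]] := full_extend i0 fac p0 q0 fp fq pqY.
have [q' [qD fq' qE]] := full_extend i0 fac q0 p0 fq fp (deriv_sym pqY).
apply: (deriv_trans pD); apply: deriv_trans _ (deriv_sym qD).
apply: VYZ_of_VY.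
  by apply: full_content => // t; rewrite pE qE !mem_cat orbC.
apply: deriv_trans (deriv_sym (VYZ_sub_Y pD)) _.
exact: deriv_trans pqY (VYZ_sub_Y qD).
Qed.

End ShapeModular.

Theorem corollary1p2 (V : semigroup_variety) :
  lower_modular_variety V -> modular_variety V.
Proof.
move=> /lower_modular_shape[triv|[M [M1 powV fullV]]];
  apply: modular_varietyP => Y Z ZY.
  move=> u v _ uv; apply: VYZ_of_Z; apply: deriv_sub uv => -[l r] [] /theoryP //=.
  by move=> /triv ->; apply: deriv_refl.
exact: shape_modular M1 powV fullV Y Z ZY.
Qed.
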